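(* Let $G$ and $H$ be Hausdorff ample groupoids. Suppose that $Z$ is a $(G,H)$-equivalence and $L = G\sqcup Z\sqcup Z^{\mathrm{op}}\sqcup H$ is the linking groupoid of $Z$. Then $L$ is a Hausdorff ample groupoid.
   Context: **Groupoids.** A groupoid $G$ is a small category in which every morphism is invertible; $r(\alpha), s(\alpha)$ denote range and source, $G^{(0)}$ is the unit space (identified with the set of identity morphisms), and $\alpha\beta$ is defined when $s(\alpha)=r(\beta)$. An étale groupoid is a groupoid with a topology such that composition and inversion are continuous and $s$ is a local homeomorphism (then so is $r$). A bisection is a subset on which $r$ and $s$ restrict to homeomorphisms (onto their images). A groupoid is ample if it is étale and has a basis of compact open bisections; a Hausdorff groupoid is ample iff it is locally compact, Hausdorff and étale with totally disconnected unit space. **Actions.** Let $G$ be a locally compact Hausdorff groupoid and $X$ a locally compact Hausdorff space. $G$ acts on the left of $X$ if there are a surjection $r_X : X \to G^{(0)}$ and a map $(\gamma,x)\mapsto\gamma\cdot x$ from $G*X := \{(\gamma,x)\in G\times X : s(\gamma) = r_X(x)\}$ to $X$ such that (1) if $(\eta,x)\in G*X$ and $(\gamma,\eta)$ is composable, then $(\gamma\eta,x),(\gamma,\eta\cdot x) \in G*X$ and $\gamma\cdot(\eta\cdot x) = (\gamma\eta)\cdot x$; (2) $r_X(x)\cdot x = x$ for all $x$. $X$ is a continuous left $G$-space if moreover $r_X$ is open and both $r_X$ and the action map are continuous. The action is free if $\gamma\cdot x = x$ implies $\gamma = r_X(x)$, and proper if $G*X\to X\times X$, $(\gamma,x)\mapsto(\gamma\cdot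 x,x)$, is proper (preimages of compact sets are compact). Right actions are defined similarly, with $s_X : X \to G^{(0)}$ and $X * G := \{(x,\gamma) : s_X(x) = r(\gamma)\}$. **Equivalence.** For locally compact Hausdorff groupoids $G,H$, a $(G,H)$-equivalence is a locally compact Hausdorff space $Z$ that is a free and proper (continuous) left $G$-space and a free and proper (continuous) right $H$-space, such that the two actions commute, $r_Z$ induces a homeomorphism of $Z/H$ onto $G^{(0)}$, and $s_Z$ induces a homeomorphism of $G\backslash Z$ onto $H^{(0)}$. If $y,z\in Z$ with $s_Z(y)=s_Z(z)$, ${}_G[y,z]\in G$ is the unique element with ${}_G[y,z]\cdot z = y$; if $y',z'\in Z$ with $r_Z(y')=r_Z(z')$, $[y',z']_H\in H$ is the unique element with $y'\cdot[y',z']_H = z'$. **Opposite space.** $Z^{\mathrm{op}} = \{\overline z : z\in Z\}$ is a homeomorphic copy of $Z$, with $r_{Z^{\mathrm{op}}}(\overline z) = s_Z(z)\in H^{(0)}$, $s_{Z^{\mathrm{op}}}(\overline z) = r_Z(z)\in G^{(0)}$, $\eta\cdot\overline z := \overline{z\cdot\eta^{-1}}$ for $\eta\in H$ with $s(\eta)=r_{Z^{\mathrm{op}}}(\overline z)$, and $\overline z\cdot\gamma := \overline{\gamma^{-1}\cdot z}$ for $\gamma\in G$ with $r(\gamma) = s_{Z^{\mathrm{op}}}(\overline z)$. **Linking groupoid.** $L := G\sqcup Z\sqcup Z^{\mathrm{op}}\sqcup H$ with the disjoint union topology, unit space $L^{(0)} = G^{(0)}\sqcup H^{(0)}$, range and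 source maps inherited from those on $G, Z, Z^{\mathrm{op}}, H$, and multiplication $kl$ given by: multiplication in $G$ or $H$ when $(k,l)$ is a composable pair in $G$ or in $H$; $kl = k\cdot l$ when $(k,l)\in (Z*H)\sqcup(G*Z)\sqcup(H*Z^{\mathrm{op}})\sqcup(Z^{\mathrm{op}}*G)$; $kl = {}_G[k,h]$ if $k\in Z$ and $l=\overline h\in Z^{\mathrm{op}}$; $kl=[h,l]_H$ if $k = \overline h\in Z^{\mathrm{op}}$ and $l\in Z$. Inversion is the usual one on $G$ and $H$, and $z\mapsto\overline z$, $\overline z\mapsto z$ on $Z$ and $Z^{\mathrm{op}}$. *)

(* Defs.v *)
From HB Require Import structures.
From mathcomp Require Import all_boot all_classical.
From mathcomp Require Import topology.

Set Implicit Arguments.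
Unset Strict Implicit.
Unset Printing Implicit Defensive.

Local Open Scope classical_set_scope.
Local Open Scope quotient_scope.

(** * Homeomorphisms *)

Definition homeomorphism (X Y : topologicalType) (f : X -> Y) : Prop :=
  continuous f /\ exists g : Y -> X, [/\ continuous g, cancel f g & cancel g f].

(* [A] and [B] are coerced to their subtypes, with the subspace topologies. *)
Definition homeo_between (X Y : topologicalType) (A : set X) (B : set Y)
    (f : X -> Y) : Prop :=
  exists2 f' : A -> B, homeomorphism f' & forall a : A, \val (f' a) = f (\val a).

Definition rel_open (Y : topologicalType) (B V : set Y) : Prop :=
  exists2 W, open W & V = B `&` W.

(* [f], whose values lie in [B], as a map from [X] to the subspace [B]. *)
Definition local_homeo_to (X Y : topologicalType) (B : set Y) (f : X -> Y) :
    Prop :=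
  forall x : X, exists U : set X,
    [/\ open U, U x, rel_open B (f @` U) & homeo_between U (f @` U) f].

Definition open_map_to (X Y : topologicalType) (B : set Y) (f : X -> Y) :
    Prop :=
  forall U : set X, open U -> rel_open B (f @` U).

Definition lc_hausdorff (X : topologicalType) : Prop :=
  locally_compact [set: X] /\ hausdorff_space X.

(** * Groupoids *)

(* A small category is given by its set [T] of morphisms, its objects being the
   identity morphisms, so that range and source are maps from [T] to [T].
   [gmul a b] is meaningful only when [gsrc a = grng b]. *)
Record groupoid_ops (T : Type) := GroupoidOps {
  grng : T -> T;
  gsrc : T -> T;
  gmul : T -> T -> T;
  ginv : T -> T
}.

Definition gunits (T : Type) (G : groupoid_ops T) : set T := range (grng G).

Definition composable (T : Type) (G : groupoid_ops T) : set (T * T) :=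
  [set p | gsrc G p.1 = grng G p.2].

Record is_groupoid (T : Type) (G : groupoid_ops T) : Prop := IsGroupoid {
  grng_rng : forall a, grng G (grng G a) = grng G a;
  gsrc_rng : forall a, gsrc G (grng G a) = grng G a;
  grng_src : forall a, grng G (gsrc G a) = gsrc G a;
  gsrc_src : forall a, gsrc G (gsrc G a) = gsrc G a;
  grng_mul : forall a b, gsrc G a = grng G b -> grng G (gmul G a b) = grng G a;
  gsrc_mul : forall a b, gsrc G a = grng G b -> gsrc G (gmul G a b) = gsrc G b;
  gmulA : forall a b c, gsrc G a = grng G b -> gsrc G b = grng G c ->
    gmul G a (gmul G b c) = gmul G (gmul G a b) c;
  gmul_rng : forall a, gmul G (grng G a) a = a;
  gmul_src : forall a, gmul G a (gsrc G a) = a;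
  grng_inv : forall a, grng G (ginv G a) = gsrc G a;
  gsrc_inv : forall a, gsrc G (ginv G a) = grng G a;
  gmulV : forall a, gmul G a (ginv G a) = grng G a;
  gmulVl : forall a, gmul G (ginv G a) a = gsrc G a
}.

Record is_etale (T : topologicalType) (G : groupoid_ops T) : Prop := IsEtale {
  etale_groupoid : is_groupoid G;
  etale_mul : {within composable G, continuous (fun p => gmul G p.1 p.2)};
  etale_inv : continuous (ginv G);
  etale_src : local_homeo_to (gunits G) (gsrc G)
}.

Definition bisection (T : topologicalType) (G : groupoid_ops T) (B : set T) :
    Prop :=
  homeo_between B (grng G @` B) (grng G) /\
  homeo_between B (gsrc G @` B) (gsrc G).

Definition is_ample (T : topologicalType) (G : groupoid_ops T) : Prop :=
  is_etale G /\
  exists2 Bs : set (set T), basis Bs &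
    forall B, Bs B -> [/\ compact B, open B & bisection G B].

Definition hausdorff_ample_groupoid (T : topologicalType)
    (G : groupoid_ops T) : Prop :=
  hausdorff_space T /\ is_ample G.

(** * Actions *)

(* [lact g x] is meaningful only when [gsrc g = lanchor x], and [ract x h] only
   when [ranchor x = grng h]. *)
Record left_action_ops (T X : Type) := LeftActionOps {
  lanchor : X -> T;
  lact : T -> X -> X
}.

Record right_action_ops (X T : Type) := RightActionOps {
  ranchor : X -> T;
  ract : X -> T -> X
}.

Section LeftActions.
Variables (T X : topologicalType) (G : groupoid_ops T).
Variable a : left_action_ops T X.

Definition lfibred : set (T * X) := [set p | gsrc G p.1 = lanchor a p.2].

Record is_left_action : Prop := IsLeftAction {
  lanchor_range : range (lanchor a) = gunits G;
  lactA : forall g h x, lfibred (h, x) -> composable G (g, h) ->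
    [/\ lfibred (gmul G g h, x), lfibred (g, lact a h x) &
        lact a g (lact a h x) = lact a (gmul G g h) x];
  lact_unit : forall x, lact a (lanchor a x) x = x
}.

Record is_left_space : Prop := IsLeftSpace {
  lspace_action : is_left_action;
  lspace_lc_hausdorff : lc_hausdorff X;
  lspace_open : open_map_to (gunits G) (lanchor a);
  lspace_anchor : continuous (lanchor a);
  lspace_act : {within lfibred, continuous (fun p => lact a p.1 p.2)}
}.

Definition left_free : Prop :=
  forall g x, lfibred (g, x) -> lact a g x = x -> g = lanchor a x.

Definition left_proper : Prop :=
  forall K : set (X * X), compact K ->
    compact (lfibred `&` [set p | K (lact a p.1 p.2, p.2)]).

Definition left_orbit (x : X) : set X :=
  [set lact a g x | g in [set g | lfibred (g, x)]].

End LeftActions.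

Section RightActions.
Variables (X T : topologicalType) (H : groupoid_ops T).
Variable a : right_action_ops X T.

Definition rfibred : set (X * T) := [set p | ranchor a p.1 = grng H p.2].

Record is_right_action : Prop := IsRightAction {
  ranchor_range : range (ranchor a) = gunits H;
  ractA : forall x h k, rfibred (x, h) -> composable H (h, k) ->
    [/\ rfibred (x, gmul H h k), rfibred (ract a x h, k) &
        ract a (ract a x h) k = ract a x (gmul H h k)];
  ract_unit : forall x, ract a x (ranchor a x) = x
}.

Record is_right_space : Prop := IsRightSpace {
  rspace_action : is_right_action;
  rspace_lc_hausdorff : lc_hausdorff X;
  rspace_open : open_map_to (gunits H) (ranchor a);
  rspace_anchor : continuous (ranchor a);
  rspace_act : {within rfibred, continuous (fun p => ract a p.1 p.2)}
}.

Definition right_free : Prop :=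
  forall x h, rfibred (x, h) -> ract a x h = x -> h = ranchor a x.

Definition right_proper : Prop :=
  forall K : set (X * X), compact K ->
    compact (rfibred `&` [set p | K (ract a p.1 p.2, p.1)]).

Definition right_orbit (x : X) : set X :=
  [set ract a x h | h in [set h | rfibred (x, h)]].

End RightActions.

(* Points are identified when their orbits are the same subset; this is an
   equivalence relation for every [orb : X -> set X]. *)
Section OrbitSpace.
Variables (X : topologicalType) (orb : X -> set X).

Definition same_orbit : rel X := fun x y => `[< orb x = orb y >].

Lemma same_orbit_refl : reflexive same_orbit.
Proof. by move=> x; apply/asboolP. Qed.

Lemma same_orbit_sym : symmetric same_orbit.
Proof. by move=> x y; apply/asboolP/asboolP. Qed.

Lemma same_orbit_trans : transitive same_orbit.
Proof.
by move=> y x z /asboolP xy /asboolP yz; apply/asboolP; rewrite xy.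
Qed.

Definition same_orbit_equiv : equiv_rel X :=
  EquivRel same_orbit same_orbit_refl same_orbit_sym same_orbit_trans.

Definition orbit_space : topologicalType :=
  quotient_topology {eq_quot same_orbit_equiv}.

Definition orbit_proj (x : X) : orbit_space :=
  \pi_{eq_quot same_orbit_equiv} x.

Definition induces_homeo (Y : topologicalType) (B : set Y) (f : X -> Y) :
    Prop :=
  exists2 F : orbit_space -> B, homeomorphism F &
    forall x, \val (F (orbit_proj x)) = f x.

End OrbitSpace.

(** * Equivalences *)

Record is_equivalence (TG TH Z : topologicalType)
    (G : groupoid_ops TG) (H : groupoid_ops TH)
    (l : left_action_ops TG Z) (r : right_action_ops Z TH) : Prop :=
  IsEquivalence {
  equiv_left : is_left_space G l;
  equiv_left_free : left_free G l;
  equiv_left_proper : left_proper G l;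
  equiv_right : is_right_space H r;
  equiv_right_free : right_free H r;
  equiv_right_proper : right_proper H r;
  equiv_commute : forall g z h, lfibred G l (g, z) -> rfibred H r (z, h) ->
    [/\ lfibred G l (g, ract r z h), rfibred H r (lact l g z, h) &
        lact l g (ract r z h) = ract r (lact l g z) h];
  equiv_lanchor : induces_homeo (right_orbit H r) (gunits G) (lanchor l);
  equiv_ranchor : induces_homeo (left_orbit G l) (gunits H) (ranchor r)
}.

(** * The opposite space *)

Definition opposite (Z : Type) : Type := Z.
HB.instance Definition _ (Z : topologicalType) := Topological.copy (opposite Z) Z.

Definition bar (Z : Type) (z : Z) : opposite Z := z.
Definition unbar (Z : Type) (z : opposite Z) : Z := z.

Definition op_left (TH Z : Type) (H : groupoid_ops TH)
    (r : right_action_ops Z TH) : left_action_ops TH (opposite Z) :=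
  LeftActionOps (fun w => ranchor r (unbar w))
                (fun h w => bar (ract r (unbar w) (ginv H h))).

Definition op_right (TG Z : Type) (G : groupoid_ops TG)
    (l : left_action_ops TG Z) : right_action_ops (opposite Z) TG :=
  RightActionOps (fun w => lanchor l (unbar w))
                 (fun w g => bar (lact l (ginv G g) (unbar w))).

(** * The linking groupoid *)

(* The brackets of the equivalence; the first arguments of [xget] are dummies,
   returned when no such element exists. *)
Definition lbracket (TG Z : topologicalType) (G : groupoid_ops TG)
    (l : left_action_ops TG Z) (y z : Z) : TG :=
  xget (lanchor l y) [set g | lfibred G l (g, z) /\ lact l g z = y].

Definition rbracket (Z TH : topologicalType) (H : groupoid_ops TH)
    (r : right_action_ops Z TH) (y z : Z) : TH :=
  xget (ranchor r y) [set h | rfibred H r (y, h) /\ ract r y h = z].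

(* The components of the linking groupoid are indexed as the entries of a
   2 x 2 matrix: the first boolean is [true] when ranges lie in the units of
   [G], and the second one when sources do. *)
Definition linking_component (TG Z TH : topologicalType) (i : bool * bool) :
    topologicalType :=
  match i with
  | (true, true) => TG
  | (true, false) => Z
  | (false, true) => opposite Z
  | (false, false) => TH
  end.

Definition linking_space (TG Z TH : topologicalType) : topologicalType :=
  {i : bool * bool & linking_component TG Z TH i}.

Section Linking.
Variables (TG Z TH : topologicalType).
Variables (G : groupoid_ops TG) (H : groupoid_ops TH).
Variables (l : left_action_ops TG Z) (r : right_action_ops Z TH).

Local Notation C := (linking_component TG Z TH).
Local Notation L := (linking_space TG Z TH).

Definition in_G (g : TG) : L := existT C (true, true) g.
Definition in_Z (z : Z) : L := existT C (true, false) z.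
Definition in_op (w : opposite Z) : L := existT C (false, true) w.
Definition in_H (h : TH) : L := existT C (false, false) h.

Definition linking_rng (k : L) : L :=
  match k with
  | existT (true, true) g => in_G (grng G g)
  | existT (true, false) z => in_G (lanchor l z)
  | existT (false, true) w => in_H (lanchor (op_left H r) w)
  | existT (false, false) h => in_H (grng H h)
  end.

Definition linking_src (k : L) : L :=
  match k with
  | existT (true, true) g => in_G (gsrc G g)
  | existT (true, false) z => in_H (ranchor r z)
  | existT (false, true) w => in_G (ranchor (op_right G l) w)
  | existT (false, false) h => in_H (gsrc H h)
  end.

(* The last case is a dummy: such pairs are never composable. *)
Definition linking_mul (k k' : L) : L :=
  match k, k' with
  | existT (true, true) g, existT (true, true) g' => in_G (gmul G g g')
  | existT (false, false) h, existT (false, false) h' => in_H (gmul H h h')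
  | existT (true, false) z, existT (false, false) h => in_Z (ract r z h)
  | existT (true, true) g, existT (true, false) z => in_Z (lact l g z)
  | existT (false, false) h, existT (false, true) w =>
      in_op (lact (op_left H r) h w)
  | existT (false, true) w, existT (true, true) g =>
      in_op (ract (op_right G l) w g)
  | existT (true, false) z, existT (false, true) w =>
      in_G (lbracket G l z (unbar w))
  | existT (false, true) w, existT (true, false) z =>
      in_H (rbracket H r (unbar w) z)
  | _, _ => k
  end.

Definition linking_inv (k : L) : L :=
  match k with
  | existT (true, true) g => in_G (ginv G g)
  | existT (true, false) z => in_op (bar z)
  | existT (false, true) w => in_Z (unbar w)
  | existT (false, false) h => in_H (ginv H h)
  end.

Definition linking_groupoid : groupoid_ops L :=
  GroupoidOps linking_rng linking_src linking_mul linking_inv.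

End Linking.

(* Main.v *)
Require Import Defs.
From mathcomp Require Import all_boot all_classical topology.

(** The point is that a topological groupoid (continuous product and inverse)
    whose units form an open set and whose source map is open is étale: if
    [y] and [z] are close to [x] and have the same source, then [y * z^-1] is
    close to a unit, so it is a unit and [y = z] ([gsrc_locally_inj],
    [etale_of_open]).  If moreover every unit has a basis of compact open
    neighbourhoods, transporting these by local inverses of the source map
    gives a basis of compact open bisections ([ample_of_units]).

    The linking groupoid inherits these properties.  Its units are the disjoint
    union of those of [G] and [H], which are open because [G] and [H] are
    étale, and which have compact open bases because [G] and [H] are ample.
    Its source map is one of the maps [gsrc G], [ranchor r], [lanchor l] and
    [gsrc H] on each component, and all of these are open.  The products not
    covered by the continuity of the groupoids and of the actions are the two
    brackets.  The left bracket of [y] and [z] is the first coordinate of the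
    only preimage of [(y, z)] under the map [(g, z) |-> (g . z, z)], which is
    continuous, proper, and injective because the action is free; so it depends
    continuously on [(y, z)], and likewise for the right bracket
    ([proper_fibre_near], [lbracket_near], [rbracket_near]).

    The groupoid laws reduce to identities between actions and brackets, since
    a bracket is determined by the equation that defines it
    ([lbracket_uniq], [rbracket_uniq]). *)

Set Implicit Arguments.
Unset Strict Implicit.
Unset Printing Implicit Defensive.

Local Open Scope classical_set_scope.

(** * Local homeomorphisms and open maps *)

Section OpenMaps.
Variables X Y : topologicalType.
Implicit Types (U V : set X) (f : X -> Y).

(** Openness is asked of [f] as a map into the whole of [Y]: the maps below
    take their values in open sets of units. *)
Lemma homeo_between_open_inj U f : continuous f ->
    (forall V, open V -> open (f @` V)) -> open U -> set_inj U f ->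
  homeo_between U (f @` U) f.
Proof.
move=> fc fo oU fi.
have fU (a : U) : f (\val a) \in f @` U.
  by apply/mem_set; exists (\val a) => //; exact: set_valP.
have gP (b : f @` U) : {a : U | f (\val a) = \val b}.
  have [x Ux xb] := cid2 (set_valP b).
  by exists (exist _ x (mem_set Ux)).
pose f' (a : U) : f @` U := exist _ (f (\val a)) (fU a).
pose g' b := sval (gP b).
have g'K b : f (\val (g' b)) = \val b := svalP (gP b).
exists f' => //; split.
  apply: continuous_comp_initial => x.
  apply: (@continuous_comp U X Y set_val f); last exact: fc.
  exact: initial_continuous.
exists g'; split.
- apply: continuous_comp_initial; apply/continuousP => W oW.
  exists (f @` (U `&` W)); first by apply: fo; exact: openI.
  rewrite eqEsubset; split => b /=.
    move=> [x [Ux Wx] xb].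
    suff -> : set_val (g' b) = x by [].
    by apply: fi; rewrite ?inE//; [exact: set_valP|rewrite xb; exact: g'K].
  move=> Wb; exists (set_val (g' b)); last exact: g'K.
  by split => //; exact: set_valP.
- move=> a; apply: val_inj; apply: fi; rewrite ?inE; try exact: set_valP.
  exact: g'K.
- by move=> b; apply: val_inj; exact: g'K.
Qed.

Lemma homeo_between_inj U f : homeo_between U (f @` U) f -> set_inj U f.
Proof.
move=> [f' [_ [g [_ fK _]]] f'E] x y /set_mem Ux /set_mem Uy xy.
pose a : U := exist _ x (mem_set Ux); pose b : U := exist _ y (mem_set Uy).
suff : a = b by move=> /(congr1 \val).
rewrite -(fK a) -(fK b); congr g; apply: val_inj.
by rewrite !f'E.
Qed.

Lemma homeo_between_open U f V : homeo_between U (f @` U) f ->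
  open (f @` U) -> open V -> open (f @` (U `&` V)).
Proof.
move=> [f' [_ [g [gc fK gK]]] f'E] ofU oV.
have : open ((set_val \o g) @^-1` V).
  apply: open_comp oV => x _.
  exact: (@continuous_comp _ U X g set_val) (gc x)
    (@initial_continuous _ _ _ _).
case=> W oW WE.
suff -> : f @` (U `&` V) = f @` U `&` W by exact: openI.
rewrite eqEsubset; split => [_ [x [Ux Vx] <-]|_ [[x Ux <-] Wx]].
  split; first by exists x.
  pose a : U := exist _ x (mem_set Ux).
  suff : (set_val @^-1` W) (f' a) by rewrite /= [set_val _]f'E.
  by rewrite WE /= fK.
pose a : U := exist _ x (mem_set Ux).
exists x => //; split => //.
have : (set_val @^-1` W) (f' a) by rewrite /= [set_val _]f'E.
by rewrite WE /= fK.
Qed.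

End OpenMaps.

(** * Groupoids *)

Section GroupoidAlgebra.
Variables (T : Type) (G : groupoid_ops T).
Hypothesis GG : is_groupoid G.

Lemma gunitsE u : gunits G u -> grng G u = u /\ gsrc G u = u.
Proof. by case=> a _ <-; rewrite (grng_rng GG) (gsrc_rng GG). Qed.

Lemma gunits_src a : gunits G (gsrc G a).
Proof. by exists (gsrc G a) => //; exact: grng_src. Qed.

Lemma gmulKl a b : gsrc G a = grng G b -> gmul G (ginv G a) (gmul G a b) = b.
Proof.
move=> ab; rewrite (gmulA GG) ?(gsrc_inv GG)//.
by rewrite (gmulVl GG) ab (gmul_rng GG).
Qed.

Lemma gmulKV a b : gsrc G a = gsrc G b ->
  gmul G (gmul G a (ginv G b)) b = a.
Proof.
move=> ab; rewrite -(gmulA GG) ?(grng_inv GG) ?(gsrc_inv GG)//.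
by rewrite (gmulVl GG) -ab (gmul_src GG).
Qed.

Lemma ginv_unit u : gunits G u -> ginv G u = u.
Proof.
move=> /gunitsE[ru su]; rewrite -[LHS](gmul_src GG) (gsrc_inv GG).
by rewrite ru (gmulVl GG).
Qed.

(** A right inverse is the inverse. *)
Lemma ginvE a b : gsrc G a = grng G b -> gmul G a b = grng G a -> b = ginv G a.
Proof.
by move=> ab e; rewrite -(gmulKl ab) e -(gsrc_inv GG) (gmul_src GG).
Qed.

Lemma ginvK : involutive (ginv G).
Proof.
move=> a; apply/esym/ginvE; rewrite ?(gsrc_inv GG)//.
by rewrite (gmulVl GG) (grng_inv GG).
Qed.

Lemma ginvM a b : gsrc G a = grng G b ->
  ginv G (gmul G a b) = gmul G (ginv G b) (ginv G a).
Proof.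
move=> ab; have ba : gsrc G (ginv G b) = grng G (ginv G a).
  by rewrite (gsrc_inv GG) (grng_inv GG).
apply/esym/ginvE.
  by rewrite (gsrc_mul GG ab) (grng_mul GG ba) (grng_inv GG).
rewrite (grng_mul GG ab) -(gmulA GG ab); last first.
  by rewrite (grng_mul GG ba) (grng_inv GG).
rewrite (gmulA GG _ ba) ?(grng_inv GG)// (gmulV GG) -ab -(grng_inv GG).
by rewrite (gmul_rng GG) (gmulV GG).
Qed.

Lemma gmulV_unit a b : gsrc G a = gsrc G b ->
  gunits G (gmul G a (ginv G b)) -> a = b.
Proof.
move=> ab /gunitsE[_ su]; rewrite -[LHS](gmulKV ab) -su.
by rewrite (gsrc_mul GG) ?(grng_inv GG)// (gsrc_inv GG) (gmul_rng GG).
Qed.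

End GroupoidAlgebra.

(** Continuity of [f] on [A], read along a map [g] sending [S] into [A]. *)
Lemma within_comp_near (X Y W : topologicalType) (A : set Y) (f : Y -> W)
    (S : set X) (g : X -> Y) (x : X) :
  {within A, continuous f} -> {for x, continuous g} ->
  (forall y, S y -> A (g y)) -> S x ->
  forall O, nbhs (f (g x)) O -> \forall y \near x, S y -> O (f (g y)).
Proof.
move=> /subspace_continuousP fc gc SA Sx O /(fc _ (SA _ Sx)).
rewrite /= !nbhs_simpl /within /= => /gc; rewrite !nbhs_simpl /=.
by apply: filterS => y yO /SA; exact: yO.
Qed.

Lemma within_near (X Y : topologicalType) (S : set X) (f : X -> Y) (x : X) :
  {within S, continuous f} -> S x -> forall O, nbhs (f x) O ->
  \forall y \near x, S y -> O (f y).
Proof.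
by move=> fc Sx O; apply: (within_comp_near (g := id)) => //; exact: cvg_id.
Qed.

Section TopologicalGroupoid.
Variables (T : topologicalType) (G : groupoid_ops T).
Hypothesis GG : is_groupoid G.
Hypothesis mulc :
  {within composable G, continuous (fun p => gmul G p.1 p.2)}.
Hypothesis invc : continuous (ginv G).

Lemma gsrc_continuous : continuous (gsrc G).
Proof.
move=> x; have -> : gsrc G = (fun y => gmul G (ginv G y) y).
  by apply/funext => y; rewrite (gmulVl GG).
move=> O nO; rewrite /= nbhs_simpl /=.
suff : \forall y \near x, setT y -> O (gmul G (ginv G y) y).
  by apply: filterS => y; exact.
apply: (within_comp_near (g := fun y => (ginv G y, y)) mulc) => //.
- by apply: cvg_pair; [exact: invc|exact: cvg_id].
- by move=> y _; rewrite /composable /= (gsrc_inv GG).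
Qed.

Lemma grng_continuous : continuous (grng G).
Proof.
move=> x; have -> : grng G = gsrc G \o ginv G.
  by apply/funext => y; rewrite /= (gsrc_inv GG).
by apply: continuous_comp; [exact: invc|exact: gsrc_continuous].
Qed.

Lemma ginv_open V : open V -> open (ginv G @` V).
Proof.
move=> oV; have -> : ginv G @` V = ginv G @^-1` V.
  rewrite eqEsubset; split => [_ [y Vy <-]/=|y /= Vy]; first by rewrite ginvK.
  by exists (ginv G y) => //; rewrite ginvK.
by apply: open_comp oV => x _; exact: invc.
Qed.

(** In an étale groupoid the units are open: near a unit, an element and its
   source lie in one set on which the source map is injective. *)
Lemma gunits_open : local_homeo_to (gunits G) (gsrc G) -> open (gunits G).
Proof.
move=> lh; rewrite openE => u Gu; have [_ su] := gunitsE GG Gu.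
have [U [oU Uu _ /homeo_between_inj Ui]] := lh u.
have : nbhs u (U `&` gsrc G @^-1` U).
  apply: filterI; first exact: open_nbhs_nbhs.
  by apply: gsrc_continuous; rewrite su; exact: open_nbhs_nbhs.
apply: filterS => x [Ux Usx].
have -> : x = gsrc G x by apply: Ui; rewrite ?inE ?(gsrc_src GG).
exact: gunits_src.
Qed.

Lemma local_homeo_open V : local_homeo_to (gunits G) (gsrc G) ->
  open V -> open (gsrc G @` V).
Proof.
move=> lh oV; rewrite openE => _ [x Vx <-].
have [U [oU Ux [W oW UW] hU]] := lh x.
have oU' : open (gsrc G @` U).
  by rewrite UW; apply: openI => //; exact: gunits_open.
have oUV := homeo_between_open hU oU' oV.
have : nbhs (gsrc G x) (gsrc G @` (U `&` V)).
  by apply: open_nbhs_nbhs; split => //; exists x.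
by apply: filterS => _ [y [_ Vy] <-]; exists y.
Qed.

Hypothesis unitso : open (gunits G).
Hypothesis srco : forall V, open V -> open (gsrc G @` V).

Lemma grng_open V : open V -> open (grng G @` V).
Proof.
move=> /ginv_open/srco; rewrite image_comp.
by have -> : gsrc G \o ginv G = grng G by apply/funext => y; exact: gsrc_inv.
Qed.

(** If [y] and [z] are close to [x] then [y * z^-1] is close to a unit, hence
   is one. *)
Lemma gsrc_locally_inj x : exists U, [/\ open U, U x & set_inj U (gsrc G)].
Proof.
pose S := [set p : T * T | gsrc G p.1 = gsrc G p.2].
have : \forall p \near (x, x), S p -> gunits G (gmul G p.1 (ginv G p.2)).
  apply: (within_comp_near (g := fun p => (p.1, ginv G p.2)) mulc) => //=.
  - apply: cvg_pair; first exact: cvg_fst.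
    apply: (@continuous_comp (T * T)%type _ _ snd); first exact: cvg_snd.
    exact: invc.
  - by move=> p pS; rewrite /composable /= (grng_inv GG).
  - by apply: open_nbhs_nbhs; split => //; rewrite (gmulV GG); exists x.
move=> [[P Q] /= [xP xQ] PQ]; exists (interior P `&` interior Q); split.
- by apply: openI; exact: open_interior.
- by split.
move=> y z /set_mem[yP _] /set_mem[_ zQ] yz.
apply: (gmulV_unit GG yz); apply: (PQ (y, z)) => //.
by split; apply: interior_subset.
Qed.

Lemma grng_locally_inj x : exists U, [/\ open U, U x & set_inj U (grng G)].
Proof.
have [U [oU Ux Ui]] := gsrc_locally_inj (ginv G x).
exists (ginv G @^-1` U); split => //.
  by apply: open_comp oU => y _; exact: invc.
move=> y z /set_mem Uy /set_mem Uz yz; apply: (can_inj (ginvK GG)).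
by apply: Ui; rewrite ?inE ?(gsrc_inv GG).
Qed.

Lemma etale_of_open : is_etale G.
Proof.
split => // x; have [U [oU Ux Ui]] := gsrc_locally_inj x.
exists U; split => //.
  exists (gsrc G @` U); first exact: srco.
  rewrite eqEsubset; split => [_ [y Uy <-]|y []//].
  by split; [exact: gunits_src|exists y].
by apply: homeo_between_open_inj => //; exact: gsrc_continuous.
Qed.

Lemma open_bisection U : open U -> set_inj U (grng G) -> set_inj U (gsrc G) ->
  bisection G U.
Proof.
move=> oU ri si; split; apply: homeo_between_open_inj => //.
- exact: grng_continuous.
- exact: grng_open.
- exact: gsrc_continuous.
Qed.

(** An open set on which the source map is injective and open carries a
   compact open set of units back to a compact open set. *)
Lemma ample_of_units :
  (forall u O, gunits G u -> nbhs u O ->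
     exists K, [/\ compact K, open K, K u & K `<=` O]) ->
  is_ample G.
Proof.
move=> hK; split; first exact: etale_of_open.
exists [set B | [/\ compact B, open B & bisection G B]] => //.
split=> [B []//|x O]; rewrite nbhsE => -[O' [oO' O'x] O'O].
have [U [oU Ux Ui]] := gsrc_locally_inj x.
have [V [oV Vx Vi]] := grng_locally_inj x.
pose D := O' `&` (U `&` V).
have oD : open D by apply: openI => //; exact: openI.
have [] := hK (gsrc G x) (gsrc G @` D); first exact: gunits_src.
  by apply: open_nbhs_nbhs; split; [exact: srco|exists x].
move=> K [cK oK Kx KD].
(* [B] is the image of [K] under the inverse of the source map on [D]. *)
pose B := D `&` gsrc G @^-1` K.
have Bi : set_inj B (gsrc G).
  by move=> y z /set_mem[[_ [Uy _]] _] /set_mem[[_ [Uz _]] _]; apply: Ui;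
    rewrite inE.
have oB : open B.
  by apply: openI => //; apply: open_comp oK => y _; exact: gsrc_continuous.
exists B; last by move=> y [[/O'O]].
split => //; split => //; last first.
  apply: open_bisection => // y z /set_mem[[_ [_ Vy]] _].
  by move=> /set_mem[[_ [_ Vz]] _]; apply: Vi; rewrite inE.
(* [g] is that inverse; its value outside [K] does not matter. *)
have gP k : exists y, K k -> B y /\ gsrc G y = k.
  have [Kk|nKk] := pselect (K k); last by exists x.
  by have [y Dy yk] := KD _ Kk; exists y => _; split => //; split=> //=;
    rewrite yk.
have [g gE] := choice gP.
have -> : B = g @` K.
  rewrite eqEsubset; split => [y By|_ [k Kk <-]]; last by have [] := gE k Kk.
  have Ky : K (gsrc G y) by case: By.
  exists (gsrc G y) => //; have [? ?] := gE _ Ky.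
  by apply: Bi; rewrite ?inE.
apply: continuous_compact => //; apply/subspace_continuousP => k Kk W.
have [Bgk gk] := gE _ Kk.
rewrite nbhsE => -[W' [oW' W'g] W'W].
rewrite nbhs_simpl /within /=.
have : nbhs k (gsrc G @` (B `&` W')).
  apply: open_nbhs_nbhs; split; first by apply: srco; exact: openI.
  by exists (g k).
apply: filterS => _ [y [By W'y] <-] Ky; apply: W'W; rewrite /from_subspace.
suff -> : g (gsrc G y) = y by [].
by have [? ?] := gE _ Ky; apply: Bi; rewrite ?inE.
Qed.

End TopologicalGroupoid.

(** * Actions, brackets and the groupoid laws of the linking groupoid *)

Section LeftActionAlgebra.
Variables (T X : topologicalType) (G : groupoid_ops T).
Variable l : left_action_ops T X.
Hypothesis GG : is_groupoid G.
Hypothesis lA : is_left_action G l.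

Lemma lanchor_units x : gunits G (lanchor l x).
Proof. by rewrite -(lanchor_range lA); exists x. Qed.

Lemma grng_lanchor x : grng G (lanchor l x) = lanchor l x.
Proof. by have [] := gunitsE GG (lanchor_units x). Qed.

Lemma gsrc_lanchor x : gsrc G (lanchor l x) = lanchor l x.
Proof. by have [] := gunitsE GG (lanchor_units x). Qed.

Lemma lactM g h x : gsrc G g = grng G h -> gsrc G h = lanchor l x ->
  lact l g (lact l h x) = lact l (gmul G g h) x.
Proof. by move=> gh hx; have [] := lactA lA hx gh. Qed.

Lemma lanchor_act g x : gsrc G g = lanchor l x ->
  lanchor l (lact l g x) = grng G g.
Proof.
move=> gx; have [|_ e _] := lactA lA (g := ginv G g) gx; first exact: gsrc_inv.
by rewrite -(gsrc_inv GG); exact/esym/e.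
Qed.

Lemma lactKV g x : gsrc G g = lanchor l x ->
  lact l (ginv G g) (lact l g x) = x.
Proof.
move=> gx; rewrite lactM ?(gsrc_inv GG)// (gmulVl GG) gx.
exact: lact_unit lA x.
Qed.

Lemma lactVK g x : grng G g = lanchor l x ->
  lact l g (lact l (ginv G g) x) = x.
Proof.
by move=> gx; rewrite -{1}(ginvK GG g) lactKV// (gsrc_inv GG).
Qed.

Lemma lact_inj g h x : left_free G l -> gsrc G g = lanchor l x ->
  gsrc G h = lanchor l x -> lact l g x = lact l h x -> g = h.
Proof.
move=> lf gx hx e.
have gh : grng G g = grng G h by rewrite -(lanchor_act gx) e lanchor_act.
have hg : gsrc G (ginv G h) = grng G g by rewrite (gsrc_inv GG).
have: gmul G (ginv G h) g = lanchor l x.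
  apply: lf; first by rewrite /lfibred /= (gsrc_mul GG hg).
  by rewrite -lactM// e lactKV.
move=> /(congr1 (gmul G h)); rewrite -hx (gmul_src GG).
by rewrite (gmulA GG) ?(grng_inv GG)// (gmulV GG) -gh (gmul_rng GG).
Qed.

Lemma left_orbit_refl x : left_orbit G l x x.
Proof.
exists (lanchor l x); last exact: lact_unit lA x.
exact: gsrc_lanchor.
Qed.

End LeftActionAlgebra.

Section RightActionAlgebra.
Variables (X T : topologicalType) (H : groupoid_ops T).
Variable r : right_action_ops X T.
Hypothesis HH : is_groupoid H.
Hypothesis rA : is_right_action H r.

Lemma ranchor_units x : gunits H (ranchor r x).
Proof. by rewrite -(ranchor_range rA); exists x. Qed.

Lemma grng_ranchor x : grng H (ranchor r x) = ranchor r x.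
Proof. by have [] := gunitsE HH (ranchor_units x). Qed.

Lemma gsrc_ranchor x : gsrc H (ranchor r x) = ranchor r x.
Proof. by have [] := gunitsE HH (ranchor_units x). Qed.

Lemma ractM x g h : ranchor r x = grng H g -> gsrc H g = grng H h ->
  ract r (ract r x g) h = ract r x (gmul H g h).
Proof. by move=> xg gh; have [] := ractA rA xg gh. Qed.

Lemma ranchor_act x h : ranchor r x = grng H h ->
  ranchor r (ract r x h) = gsrc H h.
Proof.
move=> xh; have [|_ e _] := ractA rA (k := ginv H h) xh.
  by rewrite /composable /= (grng_inv HH).
by rewrite -(grng_inv HH); exact: e.
Qed.

Lemma ractKV x h : ranchor r x = grng H h ->
  ract r (ract r x h) (ginv H h) = x.
Proof.
move=> xh; rewrite ractM ?(grng_inv HH)// (gmulV HH) -xh.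
exact: ract_unit rA x.
Qed.

Lemma ractVK x h : ranchor r x = gsrc H h ->
  ract r (ract r x (ginv H h)) h = x.
Proof.
by move=> xh; rewrite -{2}(ginvK HH h) ractKV// (grng_inv HH).
Qed.

Lemma ract_inj x g h : right_free H r -> ranchor r x = grng H g ->
  ranchor r x = grng H h -> ract r x g = ract r x h -> g = h.
Proof.
move=> rf xg xh e.
have gh : gsrc H g = gsrc H h by rewrite -(ranchor_act xg) e ranchor_act.
have hg : gsrc H g = grng H (ginv H h) by rewrite (grng_inv HH).
have: gmul H g (ginv H h) = ranchor r x.
  apply: rf; first by rewrite /rfibred /= (grng_mul HH hg).
  by rewrite -ractM// e ractKV.
by move=> u; apply: (gmulV_unit HH gh); rewrite u; exact: ranchor_units.
Qed.

Lemma right_orbit_refl x : right_orbit H r x x.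
Proof.
exists (ranchor r x); last exact: ract_unit rA x.
by rewrite /= /rfibred /= grng_ranchor.
Qed.

End RightActionAlgebra.

(** Of the homeomorphism with the orbit space, only injectivity is needed. *)
Lemma induces_homeo_orbit (X Y : topologicalType) (orb : X -> set X)
    (B : set Y) (f : X -> Y) (x y : X) :
  induces_homeo orb B f -> f x = f y -> orb x = orb y.
Proof.
case=> F [_ [F' [_ FK _]]] Ff xy.
have /(congr1 F') : F (orbit_proj orb x) = F (orbit_proj orb y).
  by apply: val_inj; rewrite /= !Ff.
by rewrite !FK => /eqmodP /asboolP.
Qed.

Section LinkingAlgebra.
Variables (TG TH Z : topologicalType).
Variables (G : groupoid_ops TG) (H : groupoid_ops TH).
Variables (l : left_action_ops TG Z) (r : right_action_ops Z TH).
Hypotheses (GG : is_groupoid G) (HH : is_groupoid H).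
Hypothesis E : is_equivalence G H l r.

Let lA : is_left_action G l := lspace_action (equiv_left E).
Let rA : is_right_action H r := rspace_action (equiv_right E).

Lemma ranchor_lact g z : gsrc G g = lanchor l z ->
  ranchor r (lact l g z) = ranchor r z.
Proof.
move=> gz; have zr : rfibred H r (z, ranchor r z).
  by rewrite /rfibred /= (grng_ranchor HH rA).
have [_ + _] := equiv_commute E gz zr.
by rewrite /rfibred /= (grng_ranchor HH rA).
Qed.

Lemma lanchor_ract z h : ranchor r z = grng H h ->
  lanchor l (ract r z h) = lanchor l z.
Proof.
move=> zh; have lz : lfibred G l (lanchor l z, z).
  by rewrite /lfibred /= (gsrc_lanchor GG lA).
have [+ _ _] := equiv_commute E lz zh.
by rewrite /lfibred /= (gsrc_lanchor GG lA).
Qed.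

Lemma lact_ract g z h : gsrc G g = lanchor l z -> ranchor r z = grng H h ->
  lact l g (ract r z h) = ract r (lact l g z) h.
Proof. by move=> gz zh; have [] := equiv_commute E gz zh. Qed.

Lemma lbracketP y z : ranchor r y = ranchor r z ->
  gsrc G (lbracket G l y z) = lanchor l z /\ lact l (lbracket G l y z) z = y.
Proof.
move=> yz; have := left_orbit_refl GG lA y.
rewrite (induces_homeo_orbit (equiv_ranchor E) yz) => -[g gz gzy].
rewrite /lbracket.
by case: xgetP => [g' -> []//|/(_ g) []]; split.
Qed.

Lemma lbracket_uniq g y z : gsrc G g = lanchor l z -> lact l g z = y ->
  lbracket G l y z = g.
Proof.
move=> gz gzy; have [|s e] := @lbracketP y z.
  by rewrite -gzy ranchor_lact.
by apply: (lact_inj GG lA (equiv_left_free E) s gz); rewrite e.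
Qed.

Lemma rbracketP y z : lanchor l y = lanchor l z ->
  ranchor r y = grng H (rbracket H r y z) /\ ract r y (rbracket H r y z) = z.
Proof.
move=> yz; have := right_orbit_refl HH rA z.
rewrite -(induces_homeo_orbit (equiv_lanchor E) yz) => -[h yh yhz].
rewrite /rbracket.
by case: xgetP => [h' -> []//|/(_ h) []]; split.
Qed.

Lemma rbracket_uniq h y z : ranchor r y = grng H h -> ract r y h = z ->
  rbracket H r y z = h.
Proof.
move=> yh yhz; have [|s e] := @rbracketP y z.
  by rewrite -yhz lanchor_ract.
by apply: (ract_inj HH rA (equiv_right_free E) s yh); rewrite e.
Qed.

Lemma grng_lbracket y z : ranchor r y = ranchor r z ->
  grng G (lbracket G l y z) = lanchor l y.
Proof.
by move=> /lbracketP[s e]; rewrite -(lanchor_act GG lA s) e.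
Qed.

Lemma gsrc_rbracket y z : lanchor l y = lanchor l z ->
  gsrc H (rbracket H r y z) = ranchor r z.
Proof.
by move=> /rbracketP[s e]; rewrite -(ranchor_act HH rA s) e.
Qed.

(** Associativity is one identity for each of the sixteen triples of components
    that can be composed.  In this and the following proofs the cases come in
    lexicographic order, the components being ordered [G], [Z], [Z^op], [H]. *)
Lemma linking_mulA a b c :
  linking_src G H l r a = linking_rng G H l r b ->
  linking_src G H l r b = linking_rng G H l r c ->
  linking_mul G H l r a (linking_mul G H l r b c) =
  linking_mul G H l r (linking_mul G H l r a b) c.
Proof.
case: a => [[[] []] a]; case: b => [[[] []] b]; case: c => [[[] []] c] /= ab bc;
  try by [have := existT_inj1 ab|have := existT_inj1 bc].
all: move: (existT_inj2 ab) (existT_inj2 bc) => {}ab {}bc; congr existT;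
  rewrite /= /bar /unbar in a b c ab bc *.
- exact: gmulA.
- by rewrite (lactM lA).
- have [s e] := lbracketP bc.
  have as_ : gsrc G a = grng G (lbracket G l b c) by rewrite grng_lbracket.
  apply/esym/lbracket_uniq; first by rewrite (gsrc_mul GG).
  by rewrite -(lactM lA) ?e.
- exact: lact_ract.
- have [s e] := lbracketP ab.
  have cV : gsrc G (ginv G c) = lanchor l b by rewrite (gsrc_inv GG).
  have cb : lanchor l (lact l (ginv G c) b) = gsrc G c.
    by rewrite (lanchor_act GG lA cV) (grng_inv GG).
  have sc : gsrc G (lbracket G l a b) = grng G c by rewrite s.
  apply: lbracket_uniq; first by rewrite (gsrc_mul GG) ?cb.
  by rewrite -(lactM lA) ?cb// (lactVK GG lA).
- have [s e] := lbracketP ab; have [s' e'] := rbracketP bc.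
  by rewrite -{1}e -{2}e' lact_ract.
- have cb : ranchor r c = grng H (ginv H b) by rewrite (grng_inv HH).
  have abc : ranchor r (ract r a b) = ranchor r c.
    by rewrite (ranchor_act HH rA).
  have [s e] := lbracketP abc.
  apply: lbracket_uniq; first by rewrite lanchor_ract.
  by rewrite lact_ract// e (ractKV HH rA).
- by rewrite (ractM rA).
- rewrite (ginvM GG bc) (lactM lA) ?(gsrc_inv GG) ?(grng_inv GG)//.
- have bV : gsrc G (ginv G b) = lanchor l a by rewrite (gsrc_inv GG).
  have abc : lanchor l (lact l (ginv G b) a) = lanchor l c.
    by rewrite (lanchor_act GG lA bV) (grng_inv GG).
  have [s e] := rbracketP abc.
  have s' : ranchor r a = grng H (rbracket H r (lact l (ginv G b) a) c).
    by rewrite -s ranchor_lact.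
  apply: rbracket_uniq => //.
  by rewrite -{2}e -lact_ract// (lactVK GG lA)// lanchor_ract.
- have [s e] := rbracketP ab; have [s' e'] := lbracketP bc.
  have gV : gsrc G (ginv G (lbracket G l b c)) = lanchor l b.
    by rewrite (gsrc_inv GG) grng_lbracket.
  have hV : ranchor r b = grng H (ginv H (rbracket H r a b)).
    by rewrite (grng_inv HH) gsrc_rbracket.
  have aE : ract r b (ginv H (rbracket H r a b)) = a.
    by rewrite -{1}e (ractKV HH rA).
  have cE : lact l (ginv G (lbracket G l b c)) b = c.
    by rewrite -{2}e' (lactKV GG lA).
  by rewrite -{1}aE lact_ract// cE.
- have [s e] := rbracketP ab.
  have sc : gsrc H (rbracket H r a b) = grng H c by rewrite gsrc_rbracket.
  apply: rbracket_uniq; first by rewrite (grng_mul HH).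
  by rewrite -(ractM rA)// e.
- by rewrite lact_ract ?(gsrc_inv GG) ?(grng_inv HH).
- have [s e] := rbracketP bc.
  have aV : ranchor r b = grng H (ginv H a) by rewrite (grng_inv HH).
  have as_ : gsrc H a = grng H (rbracket H r b c) by rewrite -s.
  apply/esym/rbracket_uniq.
    by rewrite (ranchor_act HH rA aV) (gsrc_inv HH) (grng_mul HH).
  rewrite -(ractM rA) ?(ranchor_act HH rA aV) ?(gsrc_inv HH)//.
  by rewrite (ractVK HH rA).
- by rewrite (ginvM HH ab) (ractM rA) ?(gsrc_inv HH) ?(grng_inv HH).
- exact: gmulA.
Qed.

Lemma linking_rng_mul a b :
  linking_src G H l r a = linking_rng G H l r b ->
  linking_rng G H l r (linking_mul G H l r a b) = linking_rng G H l r a.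
Proof.
move: a b => [[[] []] a] [[[] []] b] /= ab; try by have := existT_inj1 ab.
all: move: (existT_inj2 ab) => {}ab; congr existT;
  rewrite /= /bar /unbar in a b ab *.
- exact: grng_mul.
- exact: lanchor_act.
- exact: grng_lbracket.
- exact: lanchor_ract.
- by rewrite ranchor_lact// (gsrc_inv GG).
- by have [] := rbracketP ab.
- by rewrite (ranchor_act HH rA) ?(grng_inv HH)// (gsrc_inv HH).
- exact: grng_mul.
Qed.

Lemma linking_src_mul a b :
  linking_src G H l r a = linking_rng G H l r b ->
  linking_src G H l r (linking_mul G H l r a b) = linking_src G H l r b.
Proof.
move: a b => [[[] []] a] [[[] []] b] /= ab; try by have := existT_inj1 ab.
all: move: (existT_inj2 ab) => {}ab; congr existT;
  rewrite /= /bar /unbar in a b ab *.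
- exact: gsrc_mul.
- exact: ranchor_lact.
- by have [] := lbracketP ab.
- exact: ranchor_act.
- by rewrite (lanchor_act GG lA) ?(gsrc_inv GG)// (grng_inv GG).
- exact: gsrc_rbracket.
- by rewrite lanchor_ract// (grng_inv HH).
- exact: gsrc_mul.
Qed.

Lemma linking_is_groupoid : is_groupoid (linking_groupoid G H l r).
Proof.
split; rewrite /=.
- by move=> [[[] []] a]; congr existT;
    rewrite /= ?(grng_rng GG) ?(grng_rng HH) ?(grng_lanchor GG lA)
      ?(grng_ranchor HH rA).
- by move=> [[[] []] a]; congr existT;
    rewrite /= ?(gsrc_rng GG) ?(gsrc_rng HH) ?(gsrc_lanchor GG lA)
      ?(gsrc_ranchor HH rA).
- by move=> [[[] []] a]; congr existT;
    rewrite /= ?(grng_src GG) ?(grng_src HH) ?(grng_lanchor GG lA)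
      ?(grng_ranchor HH rA).
- by move=> [[[] []] a]; congr existT;
    rewrite /= ?(gsrc_src GG) ?(gsrc_src HH) ?(gsrc_lanchor GG lA)
      ?(gsrc_ranchor HH rA).
- exact: linking_rng_mul.
- exact: linking_src_mul.
- exact: linking_mulA.
- move=> [[[] []] a] /=; congr existT.
  + exact: gmul_rng.
  + exact: lact_unit lA a.
  + rewrite /bar (ginv_unit HH (ranchor_units rA _)).
    exact: ract_unit rA _.
  + exact: gmul_rng.
- move=> [[[] []] a] /=; congr existT.
  + exact: gmul_src.
  + exact: ract_unit rA a.
  + rewrite /bar (ginv_unit GG (lanchor_units lA _)).
    exact: lact_unit lA _.
  + exact: gmul_src.
- by move=> [[[] []] a] //=; congr existT; exact: grng_inv.
- by move=> [[[] []] a] //=; congr existT; exact: gsrc_inv.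
- move=> [[[] []] a] /=; congr existT.
  + exact: gmulV.
  + apply: lbracket_uniq; last exact: (lact_unit lA).
    exact: (gsrc_lanchor GG lA).
  + apply: rbracket_uniq; last exact: (ract_unit rA).
    by rewrite (grng_ranchor HH rA).
  + exact: gmulV.
- move=> [[[] []] a] /=; congr existT.
  + exact: gmulVl.
  + apply: rbracket_uniq; last exact: (ract_unit rA).
    by rewrite (grng_ranchor HH rA).
  + apply: lbracket_uniq; last exact: (lact_unit lA).
    exact: (gsrc_lanchor GG lA).
  + exact: gmulVl.
Qed.

End LinkingAlgebra.

(** * Continuity of the brackets *)

Lemma hausdorff_prod (X Y : topologicalType) :
  hausdorff_space X -> hausdorff_space Y -> hausdorff_space (X * Y)%type.
Proof.
move=> hX hY [x y] [x' y'] cl; congr pair.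
  apply: hX => A B nA nB.
  have [||[u v] [Au Bu]] := cl (A `*` setT) (B `*` setT).
  - by exists (A, setT) => //; split => //; exact: filterT.
  - by exists (B, setT) => //; split => //; exact: filterT.
  by exists u; split; [case: Au|case: Bu].
apply: hY => A B nA nB; have [||[u v] [Av Bv]] := cl (setT `*` A) (setT `*` B).
- by exists (setT, A) => //; split => //; exact: filterT.
- by exists (setT, B) => //; split => //; exact: filterT.
by exists v; split; [case: Av|case: Bv].
Qed.

(** When the fibre of a proper map over [y] is at most a point [x], the fibres
    over the points near [y] are near [x]: the part of a compact preimage away
    from [x] has a closed image, which misses [y]. *)
Lemma proper_fibre_near (X Y : topologicalType) (S : set X) (f : X -> Y)
    (K : set Y) (x : X) (y : Y) :
  hausdorff_space Y -> {within S, continuous f} ->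
  nbhs y K -> compact (S `&` f @^-1` K) ->
  (forall x', S x' -> f x' = y -> x' = x) ->
  forall O, nbhs x O ->
    \forall y' \near y, forall x', S x' -> f x' = y' -> O x'.
Proof.
move=> hY fc yK cK fy O xO.
pose D := (S `&` f @^-1` K) `&` ~` interior O.
have cD : compact D.
  by apply: compact_closedI => //; apply/open_closedC/open_interior.
have clfD : closed (f @` D).
  apply: compact_closed => //; apply: continuous_compact => //.
  by apply: continuous_subspaceW fc => z [[]].
have nfD : nbhs y (~` (f @` D)).
  apply: open_nbhs_nbhs; split; first exact: closed_openC.
  by move=> [z [[Sz _] nOz] /(fy _ Sz) zx]; apply: nOz; rewrite zx.
apply: filterS2 nfD yK => y' ny' Ky' z Sz zy'; apply: contrapT => nOz.
apply: ny'; exists z => //; split; first by split=> //; rewrite /= zy'.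
by move=> /interior_subset.
Qed.

Lemma lc_pair_nbhs (X : topologicalType) (x y : X) : lc_hausdorff X ->
  exists2 K : set (X * X), nbhs (x, y) K & compact K.
Proof.
move=> [lc _]; have [A xA [cA _]] := lc x I; have [B yB [cB _]] := lc y I.
exists (A `*` B); last exact: compact_setX.
have {}xA : \forall u \near x, setT u -> A u by exact: xA.
have {}yB : \forall u \near y, setT u -> B u by exact: yB.
exists (A, B) => //; split.
  by apply: filterS xA => u /(_ I).
by apply: filterS yB => u /(_ I).
Qed.

Section BracketContinuity.
Variables (TG TH Z : topologicalType).
Variables (G : groupoid_ops TG) (H : groupoid_ops TH).
Variables (l : left_action_ops TG Z) (r : right_action_ops Z TH).
Hypotheses (GG : is_groupoid G) (HH : is_groupoid H).
Hypothesis E : is_equivalence G H l r.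

Let lcZ : lc_hausdorff Z := lspace_lc_hausdorff (equiv_left E).
Let hZZ : hausdorff_space (Z * Z)%type := hausdorff_prod lcZ.2 lcZ.2.

Lemma lbracket_near y z O : ranchor r y = ranchor r z ->
  nbhs (lbracket G l y z) O ->
  \forall p \near (y, z), ranchor r p.1 = ranchor r p.2 ->
    O (lbracket G l p.1 p.2).
Proof.
move=> yz nO; have [K nK cK] := lc_pair_nbhs y z lcZ.
pose f (p : TG * Z) := (lact l p.1 p.2, p.2).
have fc : {within lfibred G l, continuous f}.
  apply/subspace_continuousP => p pS; apply: cvg_pair.
    by have /subspace_continuousP := lspace_act (equiv_left E); exact.
  by apply: cvg_within_filter; exact: cvg_snd.
have nO' : nbhs (lbracket G l y z, z) (O `*` setT).
  by exists (O, setT) => //; split => //; exact: filterT.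
have fy x : lfibred G l x -> f x = (y, z) -> x = (lbracket G l y z, z).
  case: x => g z' gz' [gy zz']; rewrite zz' in gz' gy *.
  by rewrite (lbracket_uniq GG HH E gz' gy).
have := proper_fibre_near hZZ fc nK (equiv_left_proper E cK) fy nO'.
apply: filterS => -[y' z'] /= h yz'; have [s e] := lbracketP GG E yz'.
by have [] := h (lbracket G l y' z', z') s; rewrite // /f /= e.
Qed.

Lemma rbracket_near y z O : lanchor l y = lanchor l z ->
  nbhs (rbracket H r y z) O ->
  \forall p \near (y, z), lanchor l p.1 = lanchor l p.2 ->
    O (rbracket H r p.1 p.2).
Proof.
move=> yz nO; have [K nK cK] := lc_pair_nbhs z y lcZ.
pose f (p : Z * TH) := (ract r p.1 p.2, p.1).
have fc : {within rfibred H r, continuous f}.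
  apply/subspace_continuousP => p pS; apply: cvg_pair.
    by have /subspace_continuousP := rspace_act (equiv_right E); exact.
  by apply: cvg_within_filter; exact: cvg_fst.
have nO' : nbhs (y, rbracket H r y z) (setT `*` O).
  by exists (setT, O) => //; split => //; exact: filterT.
have fy x : rfibred H r x -> f x = (z, y) -> x = (y, rbracket H r y z).
  case: x => z' h zh' [zz' yy']; rewrite yy' in zh' zz' *.
  by rewrite (rbracket_uniq GG HH E zh' zz').
have := proper_fibre_near hZZ fc nK (equiv_right_proper E cK) fy nO'.
move=> [[A B] [/= zA yB] AB]; exists (B, A) => // -[y' z'] [/= By' Az'] yz'.
have [s e] := rbracketP HH E yz'.
have /= h := AB (z', y') (conj Az' By').
by have [] := h (y', rbracket H r y' z') s; rewrite // /f /= e.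
Qed.

End BracketContinuity.

(** * The topology of the linking groupoid *)

Lemma sigT_hausdorff (I : choiceType) (X : I -> topologicalType) :
  (forall i, hausdorff_space (X i)) -> hausdorff_space {i & X i}.
Proof.
move=> hX [i x] [j y] cl.
have ij : i = j.
  have [_ [[x' _ <-] [y' _ /(@existT_inj1 _ X)->]]//] :=
    cl _ _ (@existT_nbhs I X _ _ _ (@filterT _ _ (nbhs_filter x)))
           (@existT_nbhs I X _ _ _ (@filterT _ _ (nbhs_filter y))).
case: _ / ij y cl => y cl; congr existT; apply: hX => A B nA nB.
have [p [[x' Ax' xE] [y' By' yE]]] :=
  cl _ _ (@existT_nbhs I X _ _ _ nA) (@existT_nbhs I X _ _ _ nB).
exists x'; split => //; have -> // : x' = y'.
by apply: (@existT_inj2 _ X i); rewrite xE yE.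
Qed.

Lemma sigT_pair_near (I : choiceType) (X : I -> topologicalType) (i j : I)
    (x : X i) (y : X j) (P : set ({i & X i} * {i & X i})) :
  (\forall p \near (x, y), P (existT X i p.1, existT X j p.2)) ->
  \forall p \near (existT X i x, existT X j y), P p.
Proof.
move=> [[A B] [/= xA yB] AB].
exists (existT X i @` A, existT X j @` B).
  by split; exact: existT_nbhs.
by move=> [u v] /= [[x' Ax' <-] [y' By' <-]]; exact: (AB (x', y')).
Qed.

Section LinkingTopology.
Variables (TG TH Z : topologicalType).
Variables (G : groupoid_ops TG) (H : groupoid_ops TH).
Variables (l : left_action_ops TG Z) (r : right_action_ops Z TH).
Hypotheses (eG : is_etale G) (eH : is_etale H).
Hypothesis E : is_equivalence G H l r.

Let GG : is_groupoid G := etale_groupoid eG.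
Let HH : is_groupoid H := etale_groupoid eH.
Local Notation C := (linking_component TG Z TH).
Local Notation L := (linking_groupoid G H l r).

(** Reduces the continuity of the product on one pair of components to that of
    the map [m] that it restricts to. *)
Lemma linking_mul_near i j k (S : set (C i * C j)) (m : C i * C j -> C k) a b :
  (forall p, composable L (existT C i p.1, existT C j p.2) -> S p) ->
  (forall p,
     gmul L (existT C i p.1) (existT C j p.2) = existT C k (m p)) ->
  (forall O, nbhs (m (a, b)) O -> \forall p \near (a, b), S p -> O (m p)) ->
  forall O, nbhs (gmul L (existT C i a) (existT C j b)) O ->
  \forall p \near (existT C i a, existT C j b),
    composable L p -> O (gmul L p.1 p.2).
Proof.
move=> LS Lm mc O; rewrite (Lm (a, b)) => /mc h; apply: sigT_pair_near.
by apply: filterS h => p h /LS/h; rewrite [gmul _ _ _]Lm.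
Qed.

Lemma linking_mul_continuous :
  {within composable L, continuous (fun p => gmul L p.1 p.2)}.
Proof.
apply/subspace_continuousP => -[a b] ab O nO.
rewrite nbhs_simpl /within /=; move: a b ab O nO => [[[] []] a] [[[] []] b] ab;
  try by have := existT_inj1 ab.
all: move: (existT_inj2 ab) => {}ab; rewrite /= in a b ab *.
- apply: (@linking_mul_near (true, true) (true, true) (true, true)
    (composable G) (fun p => gmul G p.1 p.2)) => //.
    by move=> p e; exact: existT_inj2 e.
  exact: (within_near (x := (a, b)) (etale_mul eG) ab).
- apply: (@linking_mul_near (true, true) (true, false) (true, false)
    (lfibred G l) (fun p => lact l p.1 p.2)) => //.
    by move=> p e; exact: existT_inj2 e.
  exact: (within_near (x := (a, b)) (lspace_act (equiv_left E)) ab).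
- apply: (@linking_mul_near (true, false) (false, true) (true, true)
    [set p | ranchor r p.1 = ranchor r p.2]
    (fun p => lbracket G l p.1 p.2)) => //.
    by move=> p e; exact: existT_inj2 e.
  by move=> O; apply: (lbracket_near GG HH E).
- apply: (@linking_mul_near (true, false) (false, false) (true, false)
    (rfibred H r) (fun p => ract r p.1 p.2)) => //.
    by move=> p e; exact: existT_inj2 e.
  exact: (within_near (x := (a, b)) (rspace_act (equiv_right E)) ab).
- apply: (@linking_mul_near (false, true) (true, true) (false, true)
    [set p | lanchor l p.1 = grng G p.2]
    (fun p => lact l (ginv G p.2) p.1)) => //.
    by move=> p e; exact: existT_inj2 e.
  apply: (within_comp_near (g := fun p => (ginv G p.2, p.1))
           (lspace_act (equiv_left E))) => //.
    apply: cvg_pair; last exact: cvg_fst.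
    apply: (@continuous_comp _ _ _ snd (ginv G)); first exact: cvg_snd.
    exact: etale_inv.
  by move=> p pS; rewrite /lfibred /= (gsrc_inv GG).
- apply: (@linking_mul_near (false, true) (true, false) (false, false)
    [set p | lanchor l p.1 = lanchor l p.2]
    (fun p => rbracket H r p.1 p.2)) => //.
    by move=> p e; exact: existT_inj2 e.
  by move=> O; apply: (rbracket_near GG HH E).
- apply: (@linking_mul_near (false, false) (false, true) (false, true)
    [set p | gsrc H p.1 = ranchor r p.2]
    (fun p => ract r p.2 (ginv H p.1))) => //.
    by move=> p e; exact: existT_inj2 e.
  apply: (within_comp_near (g := fun p => (p.2, ginv H p.1))
           (rspace_act (equiv_right E))) => //.
    apply: cvg_pair; first exact: cvg_snd.
    apply: (@continuous_comp _ _ _ fst (ginv H)); first exact: cvg_fst.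
    exact: etale_inv.
  by move=> p pS; rewrite /rfibred /= (grng_inv HH).
- apply: (@linking_mul_near (false, false) (false, false) (false, false)
    (composable H) (fun p => gmul H p.1 p.2)) => //.
    by move=> p e; exact: existT_inj2 e.
  exact: (within_near (x := (a, b)) (etale_mul eH) ab).
Qed.

Lemma linking_inv_continuous : continuous (ginv L).
Proof.
move=> [[[] []] a].
- move=> O nO; change (nbhs a (ginv G @^-1` (in_G Z TH @^-1` O))).
  exact: (@etale_inv _ _ eG a (in_G Z TH @^-1` O) nO).
- exact: (@existT_continuous _ C (false, true) a).
- exact: (@existT_continuous _ C (true, false) a).
- move=> O nO; change (nbhs a (ginv H @^-1` (@in_H TG Z TH @^-1` O))).
  exact: (@etale_inv _ _ eH a (@in_H TG Z TH @^-1` O) nO).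
Qed.

Let Go : open (gunits G).
Proof.
apply: gunits_open => //.
- exact: etale_mul.
- exact: etale_inv.
- exact: etale_src.
Qed.

Let Ho : open (gunits H).
Proof.
apply: gunits_open => //.
- exact: etale_mul.
- exact: etale_inv.
- exact: etale_src.
Qed.

Lemma linking_unitsE :
  gunits L = in_G Z TH @` gunits G `|` @in_H TG Z TH @` gunits H.
Proof.
rewrite eqEsubset; split => [_ [[[[] []] a] _ <-]|].
- by left; exists (grng G a) => //; exists a.
- by left; exists (lanchor l a) => //;
    exact: lanchor_units (lspace_action (equiv_left E)) a.
- by right; exists (ranchor r a) => //;
    exact: ranchor_units (rspace_action (equiv_right E)) a.
- by right; exists (grng H a) => //; exists a.
move=> _ [] [_ [a _ <-] <-]; first by exists (in_G Z TH a).
by exists (@in_H TG Z TH a).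
Qed.

Lemma linking_units_open : open (gunits L).
Proof.
rewrite linking_unitsE; apply: openU.
  exact: (@existT_open_map _ C (true, true)).
exact: (@existT_open_map _ C (false, false)).
Qed.

Lemma linking_src_open V : open V -> open (gsrc L @` V).
Proof.
move=> /sigT_openP oV; rewrite openE => _ [[i a] Va <-].
suff [j [f [fo fE]]] : exists j (f : C i -> C j),
    (forall U, open U -> open (f @` U)) /\
    forall x, gsrc L (existT C i x) = existT C j (f x).
  suff : nbhs (existT C j (f a)) (existT C j @` (f @` (existT C i @^-1` V))).
    rewrite -fE; apply: filterS => _ [_ [x Vx <-] <-].
    by exists (existT C i x) => //; exact: fE.
  apply: open_nbhs_nbhs; split; last by exists (f a) => //; exists a.
  by apply: existT_open_map; exact: fo.
move: i {a Va oV} => [[] []].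
- exists (true, true), (gsrc G); split => // U.
  apply: local_homeo_open => //;
    [exact: etale_mul|exact: etale_inv|exact: etale_src].
- exists (false, false), (ranchor r); split => // U oU.
  have [W oW ->] := rspace_open (equiv_right E) oU.
  exact: openI.
- exists (true, true), (lanchor l); split => // U oU.
  have [W oW ->] := lspace_open (equiv_left E) oU.
  exact: openI.
- exists (false, false), (gsrc H); split => // U.
  apply: local_homeo_open => //;
    [exact: etale_mul|exact: etale_inv|exact: etale_src].
Qed.

End LinkingTopology.

Theorem lemma4p3 (TG TH Z : topologicalType)
    (G : groupoid_ops TG) (H : groupoid_ops TH)
    (l : left_action_ops TG Z) (r : right_action_ops Z TH) :
  hausdorff_ample_groupoid G ->
  hausdorff_ample_groupoid H ->
  is_equivalence G H l r ->
  hausdorff_ample_groupoid (linking_groupoid G H l r).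
Proof.
move=> [hG [eG [BG [_ GB] BGB]]] [hH [eH [BH [_ HB] BHB]]] E; split.
  have hZ := (lspace_lc_hausdorff (equiv_left E)).2.
  by apply: sigT_hausdorff => -[[] []].
apply: ample_of_units.
- exact: linking_is_groupoid (etale_groupoid eG) (etale_groupoid eH) E.
- exact: linking_mul_continuous.
- exact: linking_inv_continuous.
- exact: linking_units_open.
- exact: linking_src_open.
move=> u O; rewrite (linking_unitsE E) => -[] [v _ <-] nO.
- have [K [BK Kv] KO] := GB v (in_G Z TH @^-1` O) nO.
  have [cK oK _] := BGB K BK.
  exists (in_G Z TH @` K); split.
  + apply: continuous_compact => //; apply: continuous_subspaceT.
    exact: (@existT_continuous _ _ (true, true)).
  + exact: (@existT_open_map _ _ (true, true)).
  + by exists v.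
  + by move=> _ [w /KO Ow <-].
- have [K [BK Kv] KO] := HB v (@in_H TG Z TH @^-1` O) nO.
  have [cK oK _] := BHB K BK.
  exists (@in_H TG Z TH @` K); split.
  + apply: continuous_compact => //; apply: continuous_subspaceT.
    exact: (@existT_continuous _ _ (false, false)).
  + exact: (@existT_open_map _ _ (false, false)).
  + by exists v.
  + by move=> _ [w /KO Ow <-].
Qed.
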